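(* Let $G$ be a multigraph (multiple edges allowed, no loops) with maximum degree at most $3$, and let the palette be $\mathcal{K}=\{1,2,3,4\}$. Let $M\subseteq E(G)$ be a matching whose edges are assigned arbitrary colours from $\mathcal{K}$. Then this precolouring can be extended to a proper edge-colouring of all of $G$ using only colours from $\mathcal{K}$.
   Context: A proper edge-colouring assigns colours to edges so that any two edges sharing an end-vertex (including parallel edges) receive distinct colours. Extending a precolouring means producing a proper edge-colouring of all of $G$ agreeing with the given colours on the precoloured edges. *)

(* Defs.v *)
From mathcomp Require Import all_boot.

Set Implicit Arguments.
Unset Strict Implicit.
Unset Printing Implicit Defensive.

(* Edges form a type of their own, so parallel edges are distinct elements with
   the same [ends]; [ends_card] excludes loops. *)
Record multigraph := Multigraph {
  vertex : finType;
  edge : finType;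
  ends : edge -> {set vertex};
  ends_card : forall e, #|ends e| = 2
}.

Definition degree (G : multigraph) (v : vertex G) : nat :=
  #|[set e : edge G | v \in ends e]|.

Definition max_degree (G : multigraph) : nat := \max_(v : vertex G) degree v.

Definition share_end (G : multigraph) (e f : edge G) : Prop :=
  exists v : vertex G, v \in ends e /\ v \in ends f.

Definition is_matching (G : multigraph) (M : {set edge G}) : Prop :=
  forall e f : edge G,
    e \in M -> f \in M -> e <> f -> ~ share_end e f.

Definition proper_edge_colouring (G : multigraph) (K : Type)
    (c : edge G -> K) : Prop :=
  forall e f : edge G, e <> f -> share_end e f -> c e <> c f.

Definition extends_precolouring (G : multigraph) (K : Type) (M : {set edge G})
    (p : {e : edge G | e \in M} -> K) (c : edge G -> K) : Prop :=
  forall e : {e : edge G | e \in M}, c (val e) = p e.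

(* Main.v *)
Require Import Defs.
From mathcomp Require Import all_boot.
From mathcomp Require Import zify.

(* Each edge [e] outside [M] keeps a list of at least as many colours as it has
   neighbours outside [M], since it has at most four neighbours in all. On a
   component [U] of the line graph of [G - M], colouring greedily towards an edge
   with a surplus colour succeeds, so assume that every list is tight. Then both
   ends of every edge of [U] have degree 3 and [U] has no parallel edges, so [U]
   contains a cycle [C]. A set of edges that is connected and stays so after
   deleting any one edge can be coloured from degree-sized lists unless all its
   lists coincide. If [C <> U], add to [C] an edge [g] of [U] touching it and
   colour the rest of [U] greedily towards [g |: C]; the latter is not regular,
   hence its lists are not all equal. If [C = U] and the lists coincide, the
   colours of the matching edges at the vertices of [C] alternate between two
   values, so [C] is even and two colours suffice. *)

Set Implicit Arguments.
Unset Strict Implicit.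
Unset Printing Implicit Defensive.

(** * List colourings of a finite graph from lists of at least degree size *)

Section ListColouring.

Variables (E K : finType) (k0 : K) (adj : rel E).
Hypothesis adj_sym : symmetric adj.
Hypothesis adj_irr : irreflexive adj.

Implicit Types (U W S T : {set E}) (L : E -> {set K}) (e f x y : E).

(** [e] need not belong to [U], so that neighbours in a complement or in the matching are counted by
    the same notion. *)
Definition nbrs U e := [set f in U | adj e f].

Definition list_colouring U L (c : E -> K) :=
  (forall e, e \in U -> c e \in L e) /\
  (forall e f, e \in U -> f \in U -> adj e f -> c e != c f).

Definition residual (c : E -> K) S L e := L e :\: [set c f | f in nbrs S e].

Definition adj_closed U W := [forall e in W, forall f in U, adj e f ==> (f \in W)].

(** Connectivity without paths: no proper nonempty part is closed under adjacency. The empty set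
    counts as connected. *)
Definition connected_set U :=
  [forall W : {set E}, [&& W \subset U, W != set0 & adj_closed U W] ==> (W == U)].

Lemma nbrsS S T e : S \subset T -> nbrs S e \subset nbrs T e.
Proof.
move/subsetP=> sST; apply/subsetP=> f; rewrite !inE => /andP[/sST -> ->] //.
Qed.

Lemma nbrs_split U T e : T \subset U -> #|nbrs U e| = #|nbrs T e| + #|nbrs (U :\: T) e|.
Proof.
move=> sTU; rewrite -(cardsID T (nbrs U e)); congr (_ + _); apply: eq_card => f.
  rewrite !inE; case fT: (f \in T); last by rewrite andbF.
  by rewrite (subsetP sTU _ fT) andbT.
by rewrite !inE andbA.
Qed.

Lemma nbrs_boundary U W e f :
  W \subset U -> f \in U -> f \notin W -> adj e f -> #|nbrs W e| < #|nbrs U e|.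
Proof.
move=> sWU fU fW aef; apply: proper_card; apply/properP; split; first exact: nbrsS.
by exists f; rewrite !inE ?fU ?(negPf fW).
Qed.

Lemma adj_closedP U W :
  reflect (forall e f, e \in W -> f \in U -> adj e f -> f \in W) (adj_closed U W).
Proof.
apply: (iffP forall_inP) => [H e f eW fU aef|H e eW].
  by move/(_ _ eW)/forall_inP/(_ _ fU)/implyP: H; apply.
by apply/forall_inP => f fU; apply/implyP; apply: H.
Qed.

Lemma connected_boundary U W :
  connected_set U -> W \subset U -> W != set0 -> W != U ->
  exists e f, [/\ e \in W, f \in U, f \notin W & adj e f].
Proof.
move=> /forallP /(_ W) /implyP cU sWU W0 WU.
case: (boolP (adj_closed U W)) => [cW|].
  by have /eqP EW : W == U; [apply: cU; apply/and3P | rewrite EW eqxx in WU].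
case/forall_inPn => e eW /forall_inPn[f fU]; rewrite negb_imply => /andP[aef fW].
by exists e, f.
Qed.

Lemma connected_setI U :
  (forall W, W \subset U -> W != set0 ->
     (forall e f, e \in W -> f \in U -> adj e f -> f \in W) -> U \subset W) ->
  connected_set U.
Proof.
move=> H; apply/forallP => W; apply/implyP => /and3P[sWU W0 /adj_closedP cW].
by rewrite eqEsubset sWU H.
Qed.

(** Each coloured neighbour rules out at most one colour. *)
Lemma card_residual c S L e : #|L e| <= #|residual c S L e| + #|nbrs S e|.
Proof.
rewrite -(cardsID [set c f | f in nbrs S e] (L e)) addnC leq_add2l.
exact: leq_trans (subset_leq_card (subsetIr _ _)) (leq_imset_card _ _).
Qed.

(** Residual lists exclude every conflict between [S] and [T]. The two sets may overlap, in which
    case [d] takes precedence. *)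
Lemma list_colouring_glue S T L c d :
  list_colouring S L c -> list_colouring T (residual c S L) d ->
  list_colouring (S :|: T) L (fun e => if e \in T then d e else c e).
Proof.
move=> [cL cP] [dL dP].
have mix e f : e \in T -> f \in S -> adj e f -> d e != c f.
  move=> eT fS aef; have /setDP[_] := dL _ eT; apply: contra => /eqP ->.
  by apply: imset_f; rewrite !inE fS.
split=> [e|e f]; rewrite !inE.
  case: ifP => [eT _|_ /orP[/cL //|//]]; by have /setDP[] := dL _ eT.
case: ifP => eT; case: ifP => fT; rewrite ?orbF; first by move=> _ _; exact: dP.
- by move=> _ fS; exact: mix.
- by move=> eS _; rewrite adj_sym eq_sym; exact: mix.
- exact: cP.
Qed.

(** Induction on [#|U|]: the element with a surplus in [U] is set aside and coloured last, when its
    neighbours cannot have used up its list. *)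
Lemma degenerate_colouring U L :
  (forall W, W \subset U -> W != set0 ->
     exists2 e, e \in W & #|nbrs W e| < #|L e|) ->
  exists c, list_colouring U L c.
Proof.
have [n] := ubnP #|U|; elim: n U => // n IH U leUn H.
case: (set_0Vmem U) => [->|[x xU]].
  by exists (fun=> k0); split=> [e|e f]; rewrite inE.
have [|e eU lte] := H U (subxx _); first by apply/set0Pn; exists x.
have [||c cP] := IH (U :\ e).
- by move: leUn; rewrite (cardsD1 e) eU.
- move=> W sW; apply: H; exact: subset_trans sW (subsetDl _ _).
have /card_gt0P[k kP] : 0 < #|residual c (U :\ e) L e|.
  have := card_residual c (U :\ e) L e.
  have := subset_leq_card (nbrsS e (subsetDl U [set e])); lia.
exists (fun f => if f \in [set e] then k else c f).
rewrite -(setD1K eU) setUC; apply: list_colouring_glue => //.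
by split=> [f /set1P ->|f g /set1P -> /set1P ->] //; rewrite adj_irr.
Qed.

(** The surplus at [x] settles [W = U]. Any smaller nonempty [W] has an element with a neighbour in
    [U] outside [W], and that lost neighbour is the surplus. *)
Lemma connected_slack_colouring U L x :
  connected_set U -> (forall e, e \in U -> #|nbrs U e| <= #|L e|) ->
  x \in U -> #|nbrs U x| < #|L x| -> exists c, list_colouring U L c.
Proof.
move=> cU dU xU ltx; apply: degenerate_colouring => W sWU W0.
case: (eqVneq W U) => [->|WU]; first by exists x.
have [e [f [eW fU fW aef]]] := connected_boundary cU sWU W0 WU.
exists e => //; apply: leq_trans (dU _ (subsetP sWU _ eW)).
exact: nbrs_boundary fU fW aef.
Qed.

(* Colouring [U :\: T] towards [T] always leaves an uncoloured neighbour. *)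
Lemma connected_reduce U T L :
  connected_set U -> (forall e, e \in U -> #|nbrs U e| <= #|L e|) ->
  T \subset U -> T != set0 ->
  (forall L', (forall e, e \in T -> #|nbrs T e| <= #|L' e|) ->
     exists c, list_colouring T L' c) ->
  exists c, list_colouring U L c.
Proof.
move=> cU dU sTU /set0Pn[t tT] HT.
have [c cP] : exists c, list_colouring (U :\: T) L c.
  apply: degenerate_colouring => W sW W0.
  have sWU := subset_trans sW (subsetDl _ _).
  (* As [W] misses [t], it is never all of [U], so no surplus in [U] itself is required. *)
  have WU : W != U.
    apply/eqP => WU; have := subsetP sTU t tT.
    by rewrite -WU => /(subsetP sW); rewrite inE tT.
  have [e [f [eW fU fW aef]]] := connected_boundary cU sWU W0 WU.
  exists e => //; apply: leq_trans (dU _ (subsetP sWU _ eW)).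
  exact: nbrs_boundary fU fW aef.
(* An element of [T] loses at most one colour per neighbour outside [T], so its residual list still
   has the size of its degree in [T]. *)
have [e eT|d dP] := HT (residual c (U :\: T) L).
  have := card_residual c (U :\: T) L e.
  have := dU _ (subsetP sTU _ eT); rewrite (nbrs_split e sTU); lia.
exists (fun e => if e \in T then d e else c e).
have -> : U = (U :\: T) :|: T.
  apply/setP=> e; rewrite !inE; case eT: (e \in T); last by rewrite orbF.
  by rewrite (subsetP sTU).
exact: list_colouring_glue.
Qed.

(* Spending at [x] a colour that a neighbour [y] cannot use creates slack at [y]. *)
Lemma biconnected_colouring U L x y :
  connected_set U -> (forall e, e \in U -> connected_set (U :\ e)) ->
  (forall e, e \in U -> #|nbrs U e| <= #|L e|) ->
  x \in U -> y \in U -> L x != L y -> exists c, list_colouring U L c.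
Proof.
move=> cU cU1 dU xU yU Lxy.
have step a b : a \in U -> b \in U -> adj a b -> ~~ (L a \subset L b) ->
    exists c, list_colouring U L c.
  move=> aU bU aab /subsetPn[k kLa kLb].
  pose c0 (_ : E) := k.
  have c0P : list_colouring [set a] L c0.
    by split=> [e /set1P ->|e f /set1P -> /set1P ->] //; rewrite adj_irr.
  have nba e : nbrs [set a] e = if adj e a then [set a] else set0.
    apply/setP=> f; rewrite !inE; case: (eqVneq f a) => [->|fa] /=.
      by case: (adj e a); rewrite !inE ?eqxx.
    by case: ifP; rewrite !inE ?(negPf fa).
  have dR e : e \in U :\ a -> #|nbrs (U :\ a) e| <= #|residual c0 [set a] L e|.
    case/setD1P => _ eU; have := card_residual c0 [set a] L e.
    have := dU _ eU; rewrite (@nbrs_split U [set a]) ?sub1set //; lia.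
  have ba : b != a by apply: contraTneq aab => ->; rewrite adj_irr.
  (* Once [a] has colour [k], [b] has lost a neighbour but no colour. *)
  have [||d dP] := connected_slack_colouring (x := b) (cU1 _ aU) dR.
  - by rewrite !inE ba.
  - rewrite /residual nba adj_sym aab.
    have -> : [set c0 f | f in [set a]] = [set k] by rewrite imset_set1.
    have -> : L b :\: [set k] = L b.
      by apply/setP=> j; rewrite !inE; case: eqVneq => // ->; rewrite (negPf kLb).
    apply: leq_trans (dU _ bU); apply: (@nbrs_boundary _ _ _ a) => //.
    + exact: subsetDl.
    + by rewrite !inE eqxx.
    + by rewrite adj_sym.
  exists (fun e => if e \in U :\ a then d e else c0 e).
  rewrite -{1}(setD1K aU); exact: list_colouring_glue.
(* Since [y] is not in [W], connectivity yields adjacent elements with different lists, and one of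
   these lists is not contained in the other. *)
pose W := [set e in U | L e == L x].
have [||| e [f [eW fU fW aef]]] := connected_boundary (W := W) cU.
- by apply/subsetP=> e; rewrite inE => /andP[].
- by apply/set0Pn; exists x; rewrite inE xU eqxx.
- apply: contraNneq Lxy => WU; move: yU; rewrite -WU inE => /andP[_ /eqP ->] //.
move: eW fW; rewrite !inE fU /= => /andP[eU /eqP Le] Lf.
have : L e != L f by rewrite Le eq_sym.
rewrite eqEsubset negb_and => /orP[]; apply: step => //.
by rewrite adj_sym.
Qed.

Lemma connected_setU1 S x f :
  connected_set S -> f \in S -> adj x f -> connected_set (x |: S).
Proof.
move=> cS fS axf; apply: connected_setI => W sW W0 cW.
suff sSW : S \subset W.
  rewrite subUset sSW sub1set andbT.
  by apply: (cW f); rewrite ?(subsetP sSW) ?setU11 // adj_sym.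
have [w wS wW] : exists2 w, w \in S & w \in W.
  case/set0Pn: W0 => w wW; case/setU1P: (subsetP sW _ wW) => [wx|]; last by exists w.
  by exists f => //; apply: (cW x); rewrite -?wx ?setU1r // wx.
have /forallP/(_ (W :&: S))/implyP H := cS.
apply/setIidPr/eqP/H; rewrite subsetIr /=; apply/andP; split.
  by apply/set0Pn; exists w; rewrite inE wW.
apply/adj_closedP => a b /setIP[aW aS] bS aab; rewrite inE bS andbT.
by apply: cW aab; rewrite ?setU1r.
Qed.

End ListColouring.

(** * Cycles in finite simple graphs without vertices of degree one *)

Section CycleExistence.

Variables (V : finType) (r : rel V).
Hypothesis r_sym : symmetric r.
Hypothesis r_irr : irreflexive r.
Hypothesis r_ext : forall x y, r x y -> exists2 z, z != y & r x z.

(** A path is extended backwards from its first vertex [a]: a neighbour [z] of [a] other than [b]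
    either lies further along the path and closes a cycle, or makes the path longer. Finiteness of
    [V] stops the growth. *)
Lemma ucycle_exists x y : r x y -> exists2 s, ucycle r s & 2 < size s.
Proof.
move=> rxy.
suff H n : (exists2 s, ucycle r s & 2 < size s) \/
    exists a b p, [/\ path r a (b :: p), uniq (a :: b :: p) & size p = n].
  case: (H #|V|) => // [[a [b [p [_ U sp]]]]].
  have := max_card (mem (a :: b :: p)); rewrite (card_uniqP U) /= sp => /ltnW.
  by rewrite ltnn.
elim: n => [|n [|[a [b [p [rp U sp]]]]]]; [right | by left | ].
  exists x, y, [::]; split=> //=; rewrite ?rxy // !inE andbT.
  by apply: contraTneq rxy => ->; rewrite r_irr.
have rab : r a b by case/andP: rp.
have [z zb raz] := r_ext rab.
have za : z != a by apply: contraTneq raz => ->; rewrite r_irr.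
case zp: (z \in p).
  left; case/splitPr: zp rp U sp => p1 p2.
  move=> rp U _; move: rp; rewrite -cat_cons cat_path => /andP[/andP[_ rp1] /andP[rz _]].
  have {}U : uniq (rcons (a :: b :: p1) z).
    move: U; rewrite -!cat_cons -cat_rcons cat_uniq.
    by case/andP.
  exists (rcons (a :: b :: p1) z); last by rewrite size_rcons.
  rewrite /ucycle U andbT /= !rcons_path last_rcons.
  by have rp1' : path r b p1 := rp1; rewrite rab rp1' rz /= r_sym raz.
right; exists z, a, (b :: p); split; last by rewrite /= sp.
  by rewrite /= r_sym raz.
by rewrite cons_uniq U andbT !inE negb_or za negb_or zb zp.
Qed.

End CycleExistence.

(** * The line graph of a multigraph of maximum degree at most three *)

Section LineGraph.

Variable G : multigraph.
Implicit Types (e f g : edge G) (u v w : vertex G).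

Definition edge_adj : rel (edge G) :=
  [rel e f | (e != f) && (ends e :&: ends f != set0)].

Lemma edge_adj_sym : symmetric edge_adj.
Proof. by move=> e f; rewrite /edge_adj /= eq_sym setIC. Qed.

Lemma edge_adj_irr : irreflexive edge_adj.
Proof. by move=> e; rewrite /edge_adj /= eqxx. Qed.

Lemma edge_adjP e f : reflect (e != f /\ share_end e f) (edge_adj e f).
Proof.
apply: (iffP andP) => -[nef H]; split=> //.
  by case/set0Pn: H => v /setIP[]; exists v.
by case: H => v [ve vf]; apply/set0Pn; exists v; rewrite inE ve.
Qed.

Lemma edge_adj_at v e f : e != f -> v \in ends e -> v \in ends f -> edge_adj e f.
Proof. by move=> nef ve vf; apply/edge_adjP; split=> //; exists v. Qed.

Lemma ends_pair e u v : u != v -> u \in ends e -> v \in ends e -> ends e = [set u; v].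
Proof.
move=> uv ue ve; apply/esym/eqP; rewrite eqEcard ends_card cards2 uv leqnn andbT.
by rewrite subUset !sub1set ue.
Qed.

Lemma card_star v : max_degree G <= 3 -> #|[set e : edge G | v \in ends e]| <= 3.
Proof. exact: leq_trans (leq_bigmax v). Qed.

Lemma nbrs_star e u v : ends e = [set u; v] ->
  nbrs edge_adj setT e =
  ([set f | u \in ends f] :\ e) :|: ([set f | v \in ends f] :\ e).
Proof.
move=> Ee; apply/setP=> f; rewrite !inE /edge_adj /= -andb_orr eq_sym; congr (_ && _).
apply/set0Pn/orP => [[w]|[H|H]].
- by rewrite Ee !inE => /andP[/orP[/eqP->|/eqP->] ->]; [left | right].
- by exists u; rewrite Ee !inE eqxx.
- by exists v; rewrite Ee !inE eqxx orbT.
Qed.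

(** Besides [e], the star of each end has at most two edges. By inclusion-exclusion, four neighbours
    force both stars to be full and to meet only in [e], whereas a parallel edge would lie in
    both. *)
Lemma card_nbrs_full e : max_degree G <= 3 ->
  #|nbrs edge_adj setT e| <= 4 /\
  (4 <= #|nbrs edge_adj setT e| ->
     (forall v, v \in ends e -> #|[set f : edge G | v \in ends f]| = 3) /\
     (forall f, f != e -> ends f != ends e)).
Proof.
move=> hG; have /cards2P[u [v [uv Ee]]] : #|ends e| == 2 by rewrite ends_card.
rewrite (nbrs_star Ee).
set A := [set f | u \in ends f]; set B := [set f | v \in ends f].
have eA : e \in A by rewrite inE Ee !inE eqxx.
have eB : e \in B by rewrite inE Ee !inE eqxx orbT.
have : #|A| <= 3 := card_star u hG.
have : #|B| <= 3 := card_star v hG.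
have := cardsUI (A :\ e) (B :\ e).
rewrite (cardsD1 e A) (cardsD1 e B) eA eB => HU HA HB; split; first lia.
move=> H4; split=> [w|f fe].
  by rewrite Ee !inE => /orP[/eqP->|/eqP->]; rewrite (cardsD1 e) -/A -/B ?eA ?eB; lia.
apply/eqP => Ef; suff : 0 < #|(A :\ e) :&: (B :\ e)| by lia.
by apply/card_gt0P; exists f; rewrite !inE fe Ef Ee !inE !eqxx orbT.
Qed.

End LineGraph.

(** * A cycle of length at least three, with [eps v] its edge from [v] to the next vertex *)

Section EdgeCycle.

Variables (G : multigraph) (s : seq (vertex G)) (eps : vertex G -> edge G).
Hypothesis s_uniq : uniq s.
Hypothesis s_size : 2 < size s.
Hypothesis eps_ends : forall v, v \in s -> ends (eps v) = [set v; next s v].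

Local Notation N := (next s).
Local Notation P := (prev s).
Local Notation adj := (@edge_adj G).
Local Notation C := [set eps v | v in s].

(** Induction around the cycle: the vertices of [s] form a single orbit of [next s]. *)
Lemma next_closed_sub (W : pred (vertex G)) v :
  v \in s -> W v -> (forall w, w \in s -> W w -> W (N w)) ->
  forall w, w \in s -> W w.
Proof.
move=> vs Wv cW w; rewrite -(fconnect_cycle (cycle_next s_uniq) vs) => /iter_findex <-.
suff H n : (iter n N v \in s) && W (iter n N v) by case/andP: (H (findex N v w)).
elim: n => [|n /andP[IH1 IH2]] /=; first by rewrite vs.
by rewrite mem_next IH1 cW.
Qed.

Lemma next_neq v : v \in s -> N v != v.
Proof.
move=> vs; have := ends_card (eps v); rewrite eps_ends // cards2.
by rewrite eq_sym; case: eqVneq.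
Qed.

(** Otherwise [v] and [N v] would exhaust the cycle, which has more than two vertices. *)
Lemma next2_neq v : v \in s -> N (N v) != v.
Proof.
move=> vs; apply/eqP => E2.
have /uniq_leq_size : {subset s <= [:: v; N v]}.
  move=> w; apply: (@next_closed_sub (mem [:: v; N v]) v); rewrite //= ?inE ?eqxx //.
  by move=> {}w _; rewrite !inE => /orP[/eqP->|/eqP->]; rewrite ?E2 eqxx ?orbT.
by move/(_ s_uniq); rewrite leqNgt s_size.
Qed.

Lemma eps_start v : v \in s -> v \in ends (eps v).
Proof. by move=> vs; rewrite eps_ends // !inE eqxx. Qed.

Lemma eps_stop v : v \in s -> N v \in ends (eps v).
Proof. by move=> vs; rewrite eps_ends // !inE eqxx orbT. Qed.

Lemma eps_at v w : w \in s -> v \in ends (eps w) -> w = v \/ w = P v.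
Proof.
move=> ws; rewrite eps_ends // !inE => /orP[/eqP->|/eqP->]; first by left.
by right; rewrite prev_next.
Qed.

(** If [eps v = eps w] with [w] different from [v], then [w] is both the predecessor and the
    successor of [v], which a cycle of length above two excludes. *)
Lemma eps_inj : {in s &, injective eps}.
Proof.
move=> v w vs ws E; have := eps_start vs; rewrite E => /(eps_at ws)[->//|wP].
have := eps_stop vs; rewrite E => /(eps_at ws)[wN|]; last by rewrite prev_next.
have := next2_neq vs; rewrite -wN wP next_prev // => /eqP H; case: H.
by [].
Qed.

Lemma eps_adj_next v : v \in s -> adj (eps v) (eps (N v)).
Proof.
move=> vs; have Ns : N v \in s by rewrite mem_next.
apply: (edge_adj_at (v := N v)); rewrite ?eps_start ?eps_stop //.
by apply/eqP => /eps_inj E; have := next_neq vs; rewrite -E ?eqxx.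
Qed.

Lemma eps_adj v w : v \in s -> w \in s -> adj (eps v) (eps w) -> w = N v \/ v = N w.
Proof.
move=> vs ws /edge_adjP[nvw [z []]].
move=> /(eps_at vs)[E1|E1] /(eps_at ws)[E2|E2]; subst.
- by rewrite eqxx in nvw.
- by right; rewrite next_prev.
- by left; rewrite next_prev.
- by rewrite eqxx in nvw.
Qed.

Lemma cycle_path_connected x : x \in s -> connected_set adj (C :\ eps x).
Proof.
move=> xs; apply: connected_setI => W sW /set0Pn[e eW] cW.
have inD v : v \in s -> v != x -> eps v \in C :\ eps x.
  move=> vs vx; rewrite !inE imset_f // andbT.
  by apply: contra vx => /eqP/eps_inj ->.
(* Membership of [eps v] in [W] is carried around the cycle from [N x]. The disjunct [w == x] makes
   the invariant hold at the start and absorbs the gap left by [eps x]. *)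
have const v : v \in s -> v != x -> (eps v \in W) = (eps (N x) \in W).
  move=> vs vx; apply/eqP; apply: contraTT vx => H; rewrite negbK.
  have : (v == x) || ((eps v \in W) == (eps (N x) \in W)); last by rewrite (negPf H) orbF.
  apply: (@next_closed_sub
    (fun w => (w == x) || ((eps w \in W) == (eps (N x) \in W))) x); rewrite ?eqxx //.
  move=> w ws /=; case: (eqVneq w x) => [->|wx /= /eqP <-]; first by rewrite eqxx orbT.
  case: (eqVneq (N w) x) => //= Nwx.
  have Ns : N w \in s by rewrite mem_next.
  apply/eqP; apply/idP/idP => H'; apply: cW H' _ _; rewrite ?inD ?eps_adj_next //.
  by rewrite edge_adj_sym eps_adj_next.
have sP f : f \in C :\ eps x -> exists2 v, v \in s & v != x /\ f = eps v.
  case/setD1P=> nfx /imsetP[v vs fE]; exists v => //; split=> //.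
  by apply: contra nfx => /eqP <-; rewrite fE.
apply/subsetP => f /sP[v vs [vx ->]].
have [w ws [wx eE]] := sP _ (subsetP sW _ eW).
by rewrite const // -(const w) // -eE.
Qed.

Lemma cycle_connected : connected_set adj C.
Proof.
have [x xs] : exists x, x \in s by case: (s) s_size => // x p _; exists x; exact: mem_head.
have xN : eps x \in C by exact: imset_f.
rewrite -(setD1K xN); apply: (connected_setU1 (@edge_adj_sym G) (cycle_path_connected xs)).
  2: exact: eps_adj_next.
rewrite !inE imset_f ?mem_next // andbT; apply/eqP => /eps_inj E.
by have := next_neq xs; rewrite E ?eqxx ?mem_next.
Qed.

Lemma cycle_nbrs v : v \in s -> nbrs adj C (eps v) \subset [set eps (P v); eps (N v)].
Proof.
move=> vs; apply/subsetP=> f; rewrite !inE => /andP[/imsetP[w ws ->]].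
case/(eps_adj vs ws) => ->; first by rewrite eqxx orbT.
by rewrite prev_next // eqxx.
Qed.

(** * A cycle together with one further edge at a vertex of it *)

Section CyclePlusEdge.

Variables (g : edge G) (v : vertex G).
Hypothesis vs : v \in s.
Hypothesis vg : v \in ends g.
Hypothesis g_notin : g \notin C.
Hypothesis g_simple : forall e, e \in C -> ends g != ends e.

Lemma plus_neq w : w \in s -> g != eps w.
Proof. by move=> ws; apply: contraNneq g_notin => ->; exact: imset_f. Qed.

Lemma plus_adj w z : w \in s -> z \in ends g -> z \in ends (eps w) -> adj g (eps w).
Proof. by move=> ws; apply: edge_adj_at; exact: plus_neq. Qed.

Lemma prev_stop w : w \in s -> w \in ends (eps (P w)).
Proof. by move=> ws; rewrite eps_ends ?mem_prev // next_prev // !inE eqxx orbT. Qed.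

Lemma plus_connected : connected_set adj (g |: C).
Proof.
apply: (connected_setU1 (@edge_adj_sym G) cycle_connected (f := eps v)).
  exact: imset_f.
by apply: plus_adj vg _; rewrite ?eps_start.
Qed.

(** Without [g] the cycle remains. Without a cycle edge a path remains, and it still contains one of
    the two cycle edges at [v], to which [g] attaches. *)
Lemma plus_biconnected e : e \in g |: C -> connected_set adj ((g |: C) :\ e).
Proof.
case/setU1P => [->|/imsetP[x xs ->]].
  by rewrite setU1K //; exact: cycle_connected.
have -> : (g |: C) :\ eps x = g |: (C :\ eps x).
  by rewrite setDUl (setDidPl _) // disjoints1 !inE plus_neq.
have [y [ys yx vy]] : exists y, [/\ y \in s, y != x & v \in ends (eps y)].
  case: (eqVneq v x) => [<-|vx]; last by exists v; rewrite eps_start.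
  exists (P v); rewrite mem_prev prev_stop //; split=> //.
  by apply/eqP => E; have := next_neq vs; rewrite -{1}E next_prev // eqxx.
apply: (connected_setU1 (@edge_adj_sym G) (cycle_path_connected xs) (f := eps y)).
  rewrite !inE imset_f // andbT; by apply: contra yx => /eqP/eps_inj ->.
exact: plus_adj vg vy.
Qed.

(* Regularity would force [g |: C] to be a complete line graph on a triangle,
   so that [g] is parallel to one of its edges. *)
Lemma plus_not_regular :
  exists e f, [/\ e \in g |: C, f \in g |: C &
    #|nbrs adj (g |: C) e| != #|nbrs adj (g |: C) f|].
Proof.
have Nvs : N v \in s by rewrite mem_next.
have NNvs : N (N v) \in s by rewrite mem_next.
have Pvs : P v \in s by rewrite mem_prev.
have inT w : w \in s -> eps w \in g |: C by move=> ws; rewrite inE imset_f ?orbT.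
have gT : g \in g |: C by rewrite setU11.
case: (eqVneq #|nbrs adj (g |: C) (eps v)| #|nbrs adj (g |: C) (eps (N v))|);
  last by exists (eps v), (eps (N v)); rewrite !inT.
have nPv : P v != v.
  by apply/eqP => E; have := next_neq vs; rewrite -{1}E next_prev // eqxx.
have nPN : P v != N v.
  by apply/eqP => E; have := next2_neq vs; rewrite -E next_prev // eqxx.
(* The three neighbours are [g] and the two cycle edges next to [eps v]. *)
have ge3 : 3 <= #|nbrs adj (g |: C) (eps v)|.
  have Us : uniq [:: g; eps (P v); eps (N v)].
    rewrite /= !inE !negb_or !plus_neq // !andbT.
    by apply: contra nPN => /eqP/eps_inj ->.
  apply: leq_trans (_ : #|[:: g; eps (P v); eps (N v)]| <= _).
    by rewrite (card_uniqP Us).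
  apply: subset_leq_card; apply/subsetP => f.
  rewrite !inE => /or3P[] /eqP->.
  - by rewrite eqxx edge_adj_sym (plus_adj vs vg) ?eps_start.
  - rewrite imset_f // orbT edge_adj_sym.
    by have := eps_adj_next Pvs; rewrite next_prev.
  - by rewrite imset_f // orbT eps_adj_next.
have nbN : nbrs adj (g |: C) (eps (N v)) \subset [set g; eps v; eps (N (N v))].
  apply/subsetP => f; rewrite !inE => /andP[/orP[->//|fC] aNf].
  have : f \in nbrs adj C (eps (N v)) by rewrite inE fC.
  by move/(subsetP (cycle_nbrs Nvs)); rewrite !inE prev_next // -orbA => ->; rewrite orbT.
(* If [g] misses [eps (N v)], that edge has at most two neighbours, against the assumed equality
   with [eps v]. *)
case: (boolP (adj g (eps (N v)))) => [ag _|nag E]; last first.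
  have : #|nbrs adj (g |: C) (eps (N v))| <= #|[set eps v; eps (N (N v))]|.
    apply: subset_leq_card; apply/subsetP => f fn.
    have := subsetP nbN _ fn; rewrite !inE -orbA => /or3P[/eqP fg|->|->]; rewrite ?orbT //.
    by move: fn; rewrite fg inE edge_adj_sym (negPf nag) andbF.
  by rewrite cards2; move: ge3; rewrite E; case: (_ != _); lia.
(* Were [g] to meet [eps (N v)] at [N v], it would be parallel to [eps v]. So [g] is a chord from
   [v] to [N (N v)]. *)
have gN2 : N (N v) \in ends g.
  case/edge_adjP: ag => _ [z [zg]]; rewrite eps_ends // !inE => /orP[]/eqP zE; rewrite -zE //.
  have /eqP[] := g_simple (imset_f eps vs).
  by rewrite eps_ends //; apply: ends_pair; rewrite -?zE // zE eq_sym next_neq.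
(* On a triangle this chord would be parallel to [eps (P v)]. *)
have nP2 : P v != N (N v).
  apply/eqP => E; have /eqP[] := g_simple (imset_f eps Pvs).
  by rewrite eps_ends // next_prev //; apply: ends_pair => //; rewrite E.
(* The chord [g] meets four distinct cycle edges, two at each end, while [eps (N v)] has at most
   three neighbours. *)
exists g, (eps (N v)); rewrite gT inT //; split=> //.
have le3 := subset_leq_card nbN.
have : #|[set g; eps v; eps (N (N v))]| <= 3.
  rewrite setUC cardsU1 cards2; by case: (_ \notin _); case: (_ != _).
suff : 4 <= #|nbrs adj (g |: C) g| by lia.
have Us : uniq (map eps [:: v; P v; N v; N (N v)]).
  rewrite map_inj_in_uniq.
    rewrite /= !inE !negb_or (eq_sym v) nPv (eq_sym v) next_neq // (eq_sym v) next2_neq //.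
    by rewrite nPN nP2 eq_sym next_neq.
  move=> a b; rewrite !inE => Ha Hb; apply: eps_inj.
    by case/or4P: Ha => /eqP->.
  by case/or4P: Hb => /eqP->.
apply: leq_trans (_ : #|map eps [:: v; P v; N v; N (N v)]| <= _).
  by rewrite (card_uniqP Us).
apply: subset_leq_card; apply/subsetP => f.
rewrite !inE => /or4P[] /eqP->; rewrite imset_f // orbT /=.
- exact: plus_adj vg (eps_start vs).
- exact: plus_adj vg (prev_stop vs).
- exact: ag.
- exact: plus_adj gN2 (eps_start NNvs).
Qed.

End CyclePlusEdge.

End EdgeCycle.

(** * The lists left by the precoloured matching *)

Section MatchingExtension.

Variables (G : multigraph) (M : {set edge G}) (p : edge G -> 'I_4).
Hypothesis hG : max_degree G <= 3.
Hypothesis hM : is_matching M.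

Local Notation adj := (@edge_adj G).
Implicit Types (U : {set edge G}) (e f g m : edge G) (v w : vertex G).

Definition forbidden e := [set p m | m in nbrs adj M e].
Definition available e := ~: forbidden e.

Lemma matching_unique v e f :
  e \in M -> f \in M -> v \in ends e -> v \in ends f -> e = f.
Proof.
move=> eM fM ve vf; apply/eqP; apply/negPn/negP => /eqP nef.
by case: (hM eM fM nef); exists v.
Qed.

Lemma card_available e : #|forbidden e| + #|available e| = 4.
Proof. by rewrite cardsC card_ord. Qed.

Lemma card_nbrs_outside U e : U \subset ~: M ->
  #|nbrs adj U e| + #|nbrs adj M e| <= #|nbrs adj setT e|.
Proof.
move=> sUM; rewrite (nbrs_split adj e (subsetT M)) addnC leq_add2l.
by apply/subset_leq_card/nbrsS; rewrite setTD.
Qed.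

Lemma nbrs_le_available U e : U \subset ~: M -> #|nbrs adj U e| <= #|available e|.
Proof.
move=> sUM; have := card_nbrs_outside e sUM.
have [] := card_nbrs_full e hG; have := card_available e.
have : #|forbidden e| <= #|nbrs adj M e| := leq_imset_card _ _.
lia.
Qed.

(** Tightness turns every estimate behind [nbrs_le_available] into an equality: [e] has four
    neighbours in all, and its neighbours in [M] forbid distinct colours. *)
Lemma tight_edge U e : U \subset ~: M -> #|available e| <= #|nbrs adj U e| ->
  [/\ forall v, v \in ends e -> #|[set f : edge G | v \in ends f]| = 3,
      forall f, f != e -> ends f != ends e
    & {in nbrs adj M e &, injective p}].
Proof.
move=> sUM tight; have := card_nbrs_outside e sUM.
have [le4 full] := card_nbrs_full e hG; have := card_available e.
have : #|forbidden e| <= #|nbrs adj M e| := leq_imset_card _ _.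
move=> H1 H2 H3; have [|st si] := full; first lia.
split=> //; apply/imset_injP; rewrite -/(forbidden e); apply/eqP; lia.
Qed.

(** * Closed sets of edges outside the matching on which every list is tight *)

Section TightComponent.

Variable U : {set edge G}.
Hypothesis sUM : U \subset ~: M.
Hypothesis cUM : forall e f, e \in U -> f \notin M -> adj e f -> f \in U.
Hypothesis tight : forall e, e \in U -> #|nbrs adj U e| = #|available e|.

Lemma tightP e : e \in U ->
  [/\ forall v, v \in ends e -> #|[set f : edge G | v \in ends f]| = 3,
      forall f, f != e -> ends f != ends e
    & {in nbrs adj M e &, injective p}].
Proof. by move=> eU; apply: (tight_edge sUM); rewrite tight. Qed.

(** Of the two edges other than [e] at [v], the matching contains at most one. *)
Lemma tight_branch e v : e \in U -> v \in ends e ->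
  exists f, [/\ f \in U, f != e & v \in ends f].
Proof.
move=> eU ve; have [st _ _] := tightP eU.
have eS : e \in [set f : edge G | v \in ends f] by rewrite inE.
have /eqP/cards2P[a [b [nab Eab]]] : #|[set f : edge G | v \in ends f] :\ e| = 2.
  by have := st v ve; rewrite (cardsD1 e) eS; lia.
have inS f : f \in [set a; b] -> f != e /\ v \in ends f.
  by rewrite -Eab !inE => /andP[].
have [ae va] := inS a (set21 _ _); have [be vb] := inS b (set22 _ _).
have toU f : f \notin M -> f != e -> v \in ends f -> f \in U.
  move=> fM fe vf; apply: (cUM eU fM); apply: edge_adj_at ve vf.
  by rewrite eq_sym.
case: (boolP (a \in M)) => aM; last by exists a; split=> //; exact: toU.
case: (boolP (b \in M)) => bM; last by exists b; split=> //; exact: toU.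
by rewrite (matching_unique aM bM va vb) eqxx in nab.
Qed.

Lemma tight_cycle : U != set0 -> exists s eps,
  [/\ uniq s, 2 < size s, forall v, v \in s -> ends (eps v) = [set v; next s v]
    & forall v, v \in s -> eps v \in U].
Proof.
case/set0Pn=> e0 e0U; pose r := [rel u v | [exists e in U, ends e == [set u; v]]].
have r_sym : symmetric r by move=> u v /=; rewrite setUC.
have r_irr : irreflexive r.
  move=> u /=; apply/negbTE/negP => /exists_inP[e _ /eqP Ee].
  by have := ends_card e; rewrite Ee setUid cards1.
(* The edge [f] that continues at [x] is not parallel to [e], so it leads to a vertex other than
   [y]. *)
have r_ext x y : r x y -> exists2 z, z != y & r x z.
  case/exists_inP=> e eU /eqP Ee; have xe : x \in ends e by rewrite Ee set21.
  have [f [fU fe xf]] := tight_branch eU xe.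
  have /card_gt0P[z] : 0 < #|ends f :\ x|.
    by have := ends_card f; rewrite (cardsD1 x) xf; lia.
  rewrite !inE => /andP[zx zf].
  have Ef : ends f = [set x; z] by apply: ends_pair; rewrite // eq_sym.
  exists z; last by apply/exists_inP; exists f; rewrite ?Ef.
  by have [_ si _] := tightP eU; apply: contraNneq (si f fe) => zy; rewrite Ef Ee zy.
have /cards2P[x [y [_ E0]]] : #|ends e0| == 2 by rewrite ends_card.
have rxy : r x y by apply/exists_inP; exists e0; rewrite ?E0.
have [s /andP[cs us] ss] := ucycle_exists r_sym r_irr r_ext rxy.
(* The default [e0] is never taken at a vertex of [s], since consecutive vertices are joined by an
   edge of [U]. *)
pose eps v := odflt e0 [pick e in U | ends e == [set v; next s v]].
have epsP v : v \in s -> eps v \in U /\ ends (eps v) = [set v; next s v].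
  move=> vs; rewrite /eps; case: pickP => [e /andP[? /eqP]//|/= H].
  by have /exists_inP[e eU Ee] := next_cycle cs vs; have := H e; rewrite eU Ee.
by exists s, eps; split=> // v /epsP[].
Qed.

Section OnCycle.

Variables (s : seq (vertex G)) (eps : vertex G -> edge G).
Hypothesis s_uniq : uniq s.
Hypothesis s_size : 2 < size s.
Hypothesis eps_ends : forall v, v \in s -> ends (eps v) = [set v; next s v].
Hypothesis epsU : forall v, v \in s -> eps v \in U.
Hypothesis cU : connected_set adj U.

Local Notation C := [set eps v | v in s].
Local Notation N := (next s).
Local Notation P := (prev s).

(** The third edge at [v] is not on the cycle; outside [M] it would be in [U], hence on the cycle
    after all. *)
Lemma cycle_matched v : C = U -> v \in s -> exists2 m, m \in M & v \in ends m.
Proof.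
move=> CU vs; have [st _ _] := tightP (epsU vs).
have : ~~ ([set f | v \in ends f] \subset [set eps v; eps (P v)]).
  apply/negP => /subset_leq_card; rewrite st ?(eps_start eps_ends) // cards2.
  by case: (_ != _).
case/subsetPn => f; rewrite !inE negb_or => vf /andP[nf nPf].
exists f => //; apply: contraTT isT => fM.
have : f \in U.
  apply: (cUM (epsU vs) fM); apply: edge_adj_at (eps_start eps_ends vs) vf.
  by rewrite eq_sym.
rewrite -CU => /imsetP[w ws fE]; move: vf nf nPf; rewrite fE.
by case/(eps_at s_uniq eps_ends ws) => ->; rewrite eqxx.
Qed.

(* All lists being equal, the colours of the matching edges hanging from the
   cycle alternate between two values; colour each cycle edge according to
   the matching edge at its starting vertex. *)
Lemma cycle_alternating_colouring : C = U ->
  {in U &, forall e f, available e = available f} ->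
  exists c, list_colouring adj U available c.
Proof.
move=> CU Leq.
have [v0 v0s] : exists v, v \in s.
  by case: (s) s_size => // x q _; exists x; exact: mem_head.
have Aeq e : e \in U -> forbidden e = forbidden (eps v0).
  by move=> eU; apply: setC_inj; apply: Leq; rewrite ?epsU.
(* The two neighbours on the cycle give two available colours by tightness, so at most two of the
   four colours are forbidden. *)
have Le2 : 2 <= #|available (eps v0)|.
  rewrite -tight ?epsU //.
  apply: leq_trans (_ : #|[set eps (N v0); eps (P v0)]| <= _).
    rewrite cards2; case: eqVneq => // E.
    have E1 : N v0 = P v0.
      by apply: (eps_inj s_uniq s_size eps_ends) E; rewrite ?mem_next ?mem_prev.
    by have := next2_neq s_uniq s_size v0s; rewrite E1 next_prev // eqxx.
  apply: subset_leq_card; rewrite subUset !sub1set !inE !epsU ?mem_next ?mem_prev //=.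
  rewrite (eps_adj_next s_uniq s_size eps_ends) // edge_adj_sym.
  have Pv : P v0 \in s by rewrite mem_prev.
  by have := eps_adj_next s_uniq s_size eps_ends Pv; rewrite next_prev.
have Ae2 : #|forbidden (eps v0)| <= 2 by have := card_available (eps v0); lia.
have /card_gt1P[k1 [k2 [k1L k2L k12]]] := Le2.
have [m0 m0M vm0] := cycle_matched CU v0s.
pose mark v := [exists m in M, (v \in ends m) && (p m == p m0)].
have markE v m : m \in M -> v \in ends m -> mark v = (p m == p m0).
  move=> mM vm; apply/exists_inP/idP => [[m' m'M /andP[vm']]|pm].
    by rewrite (matching_unique m'M mM vm' vm).
  by exists m; rewrite ?vm.
have neqM v m : v \in s -> m \in M -> eps v != m.
  move=> vs mM; apply: contraTneq mM => <-.
  by have := subsetP sUM _ (epsU vs); rewrite inE.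
(* The matching edges [m] and [n] at the ends of [eps v] differ, as a common one would be parallel
   to [eps v], so tightness gives them different colours. These two and [p m0] lie in a set of at
   most two colours, so exactly one of them equals [p m0]. *)
have markN v : v \in s -> mark (N v) = ~~ mark v.
  move=> vs; have Nvs : N v \in s by rewrite mem_next.
  have [m mM vm] := cycle_matched CU vs; have [n nM vn] := cycle_matched CU Nvs.
  rewrite (markE _ _ mM vm) (markE _ _ nM vn).
  have [_ si inj] := tightP (epsU vs).
  have mN : m \in nbrs adj M (eps v).
    by rewrite inE mM; apply: edge_adj_at (eps_start eps_ends vs) vm; exact: neqM.
  have nN : n \in nbrs adj M (eps v).
    by rewrite inE nM; apply: edge_adj_at (eps_stop eps_ends vs) vn; exact: neqM.
  have nmn : m != n.
    apply/eqP => mn; have : m != eps v by rewrite eq_sym neqM.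
    move/si; rewrite eps_ends // => /eqP; apply.
    by apply: ends_pair; rewrite ?mn // -?mn // eq_sym (next_neq eps_ends).
  have pmn : p m != p n by apply: contra nmn => /eqP/inj ->.
  have pA : [set p m0; p m; p n] \subset forbidden (eps v0).
    have pF n' : n' \in nbrs adj M (eps v) -> p n' \in forbidden (eps v0).
      by rewrite -(Aeq _ (epsU vs)); exact: imset_f.
    rewrite !subUset !sub1set (pF m) // (pF n) // !andbT.
    apply: imset_f; rewrite inE m0M.
    by apply: edge_adj_at (eps_start eps_ends v0s) vm0; exact: neqM.
  have := leq_trans (subset_leq_card pA) Ae2.
  rewrite -setUA cardsU1 cards2 pmn !inE (eq_sym (p m0)) (eq_sym (p m0)).
  case: (eqVneq (p m) (p m0)) => [<-|_]; first by rewrite eq_sym (negPf pmn).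
  by case: eqVneq.
pose c e := if e \in [set eps v | v in s & mark v] then k1 else k2.
have cE v : v \in s -> c (eps v) = if mark v then k1 else k2.
  move=> vs; rewrite /c; congr (if _ then _ else _).
  apply/imsetP/idP => [[w]|mv]; last by exists v; rewrite // inE vs.
  rewrite inE => /andP[ws mw] /(eps_inj s_uniq s_size eps_ends) -> //.
have cN v : v \in s -> c (eps v) != c (eps (N v)).
  move=> vs; rewrite !cE ?mem_next // markN //.
  by case: (mark v); rewrite //= eq_sym.
exists c; split=> [e eU|e f].
  by rewrite (Leq e (eps v0)) ?epsU // /c; case: ifP.
rewrite -CU => /imsetP[v vs ->] /imsetP[w ws ->].
case/(eps_adj s_uniq eps_ends vs ws) => ->; first exact: cN.
by rewrite eq_sym; exact: cN.
Qed.

Lemma tight_cycle_colouring : exists c, list_colouring adj U available c.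
Proof.
have symA := @edge_adj_sym G; have irrA := @edge_adj_irr G.
have conC := cycle_connected s_uniq s_size eps_ends.
have dU e : e \in U -> #|nbrs adj U e| <= #|available e| by move/tight->.
have sCU : C \subset U by apply/subsetP => e /imsetP[v /epsU vU ->].
case: (eqVneq C U) => [CU|nCU].
  case: (boolP [forall e in U, forall f in U, available e == available f]) => [H|].
    apply: cycle_alternating_colouring CU _ => e f eU fU.
    by apply/eqP; move/forall_inP/(_ e eU)/forall_inP/(_ f fU): H.
  case/forall_inPn => e eU /forall_inPn[f fU nef].
  apply: (biconnected_colouring ord0 symA irrA cU _ dU eU fU nef) => g.
  by rewrite -CU => /imsetP[v vs ->]; exact: cycle_path_connected.
have [|e [g [/imsetP[u us ->] gU gC /edge_adjP[nge [v [vu vg]]]]]] :=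
  connected_boundary cU sCU _ nCU.
  have [v vs] : exists v, v \in s.
    by case: (s) s_size => // x q _; exists x; exact: mem_head.
  by apply/set0Pn; exists (eps v); exact: imset_f.
(* The vertex where [g] touches the cycle edge lies on the cycle. *)
have vs : v \in s.
  by have [] := eps_at s_uniq eps_ends us vu => E; move: us; rewrite E ?mem_prev.
have g_simple f : f \in C -> ends g != ends f.
  move=> fC; have [_ si _] := tightP (subsetP sCU _ fC); apply: si.
  by apply: contraNneq gC => ->.
have conT := plus_connected s_uniq s_size eps_ends vs vg gC.
have biT := plus_biconnected s_uniq s_size eps_ends vs vg gC.
apply: (connected_reduce ord0 symA irrA cU dU (T := g |: C)).
- by rewrite subUset sub1set gU.
- by apply/set0Pn; exists g; exact: setU11.
move=> L' dL'.
have [x [y [xT yT nxy]]] := plus_not_regular s_uniq s_size eps_ends vs vg gC g_simple.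
(* Either [x] or [y] has a surplus, or both lists have exactly degree size and therefore differ,
   because the degrees do. *)
case: (ltngtP #|nbrs adj (g |: C) x| #|L' x|) (dL' x xT) => // [ltx _|Ex _].
  exact: (connected_slack_colouring ord0 symA irrA conT dL' xT ltx).
case: (ltngtP #|nbrs adj (g |: C) y| #|L' y|) (dL' y yT) => // [lty _|Ey _].
  exact: (connected_slack_colouring ord0 symA irrA conT dL' yT lty).
apply: (biconnected_colouring ord0 symA irrA conT biT dL' xT yT).
by apply: contra nxy => /eqP E; rewrite Ex Ey E.
Qed.

End OnCycle.

End TightComponent.

(** [U] may be any union of components of the line graph of [G - M]. By induction on [#|U|], a
    disconnected [U] splits into two closed parts with no adjacency between them, whose colourings
    combine freely. *)
Lemma component_colouring U :
  U \subset ~: M -> adj_closed adj (~: M) U ->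
  exists c, list_colouring adj U available c.
Proof.
have symA := @edge_adj_sym G; have irrA := @edge_adj_irr G.
have [n] := ubnP #|U|; elim: n U => // n IH U leUn sUM /adj_closedP cUM.
have [U0|UN0] := eqVneq U set0.
  by exists (fun=> ord0); rewrite U0; split=> [e|e f]; rewrite inE.
case: (boolP (connected_set adj U)) => [cU|].
  have dU e : e \in U -> #|nbrs adj U e| <= #|available e|.
    by move=> _; exact: nbrs_le_available.
  case: (boolP [exists e in U, #|nbrs adj U e| < #|available e|]) => [/exists_inP[e eU lte]|].
    exact: (connected_slack_colouring ord0 symA irrA cU dU eU lte).
  rewrite negb_exists_in => /forall_inP ntight.
  have tight e : e \in U -> #|nbrs adj U e| = #|available e|.
    by move=> eU; apply/eqP; rewrite eqn_leq dU // leqNgt ntight.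
  have cUM' e f : e \in U -> f \notin M -> adj e f -> f \in U.
    by move=> eU fM; apply: cUM => //; rewrite inE.
  have [s [eps [us ss ee eU]]] := tight_cycle sUM cUM' tight UN0.
  exact: (tight_cycle_colouring sUM cUM' tight us ss ee eU cU).
case/forallPn => W; rewrite negb_imply => /andP[/and3P[sWU WN0 /adj_closedP cW] nWU].
have [x xW] := set0Pn _ WN0.
have pWU : W \proper U by rewrite properEneq nWU.
have cD e f : e \in U :\: W -> f \in U -> adj e f -> f \in U :\: W.
  case/setDP=> eU eW fU aef; rewrite inE fU andbT; apply: contra eW => fW.
  by apply: cW fW eU _; rewrite symA.
have [|||c [cL cP]] := IH W.
- exact: leq_trans (proper_card pWU) _.
- exact: subset_trans sWU sUM.
- apply/adj_closedP => e f eW fM aef; apply: (cW e) => //.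
  by apply: (cUM e) => //; exact: (subsetP sWU).
have [|||d [dL dP]] := IH (U :\: W).
- have := cardsID W U; rewrite (setIidPr sWU).
  have : 0 < #|W| by apply/card_gt0P; exists x.
  move: leUn; lia.
- exact: subset_trans (subsetDl _ _) sUM.
- apply/adj_closedP => e f eD fM aef; apply: (cD e) => //.
  by case/setDP: eD => eU _; apply: (cUM e).
exists (fun e => if e \in W then c e else d e); split=> [e eU|e f eU fU aef].
  by case: ifP => [/cL//|eW]; apply: dL; rewrite inE eW.
case: ifP => eW.
  by rewrite (cW e f) //; apply: cP => //; exact: cW aef.
have eD : e \in U :\: W by rewrite inE eW.
have fD := cD _ _ eD fU aef; case: ifP => fW; last exact: dP.
by move: fD; rewrite inE fW.
Qed.

End MatchingExtension.

Theorem theorem1p7 (G : multigraph) (hG : max_degree G <= 3)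
    (M : {set edge G}) (hM : is_matching M)
    (p : {e : edge G | e \in M} -> 'I_4) :
  exists c : edge G -> 'I_4,
    proper_edge_colouring c /\ extends_precolouring p c.
Proof.
(* The default [ord0] is harmless: [forbidden] reads [q] only on [M]. *)
pose q e := if insub e is Some m then p m else ord0 : 'I_4.
have [|c [cL cP]] := component_colouring q hG hM (subxx (~: M)).
  by apply/adj_closedP.
have mix e f : e \in M -> f \notin M -> edge_adj f e -> c f != q e.
  move=> eM fM afe; have := cL f; rewrite !inE => /(_ fM); apply: contraNneq => ->.
  by apply: imset_f; rewrite inE eM.
exists (fun e => if e \in M then q e else c e); split=> [e f nef sef|[e eM]] /=; last first.
  by rewrite eM /q insubT.
have aef : edge_adj e f by apply/edge_adjP; split=> //; exact/eqP.
apply/eqP; case: ifP => eM; case: ifP => fM.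
- by case: (hM e f eM fM nef).
- by rewrite eq_sym mix ?fM // edge_adj_sym.
- by rewrite mix ?eM.
- by apply: cP; rewrite ?inE ?eM ?fM.
Qed.
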